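(* Let $p$ and $q$ be two distributions on $[k]$, and let $\epsilon$ satisfy $e^\epsilon\gtrsim\frac{1}{d_{\mathrm h}^2(p,q)}\log\left(\frac{1}{d_{\mathrm h}^2(p,q)}\right)$. Then $n^*(p,q,\epsilon)\asymp n^*(p,q)$. Moreover, there is a channel $\mathbf T$ achieving this sample complexity (an $\epsilon$-LDP channel used identically by all users) that maps $[k]$ to a domain of size $\lceil\log(n^*(p,q))\rceil$, and which can be computed in $\mathrm{poly}(k,\log(\lceil n^*(p,q)\rceil))$ time.
   Context: $[k]=\{1,\dots,k\}$, $d_{\mathrm h}^2(p,q)=\sum_i(\sqrt{p_i}-\sqrt{q_i})^2$. The notations $\lesssim,\gtrsim,\asymp$ hide universal positive constants; in particular the hypothesis means that $e^\epsilon\ge C\cdot\frac{1}{d_{\mathrm h}^2(p,q)}\log\left(\frac{1}{d_{\mathrm h}^2(p,q)}\right)$ for a suitable universal constant $C>0$. A channel $\mathbf T$ from $\mathcal X$ to a countable set $\mathcal Y$ is a transition kernel $\mathbf T(y,x)=\mathbb P(Y=y\mid X=x)$, also viewed as a stochastic map $Y=\mathbf T(X)$. It is $\epsilon$-LDP if $\mathbf T(y,x)\le e^\epsilon\,\mathbf T(y,x')$ for all $x,x'\in\mathcal X$, $y\in\mathcal Y$. Sample complexity $n^*(p,q,\epsilon)$: the smallest $n$ for which there exist a deterministic rule assigning to each user $i\in[n]$ an $\epsilon$-LDP channel $\mathbf T_i$ from $\mathcal X$ to $\mathbb N$, and a test $\phi$ with values in $\{p,q\}$, such that, when $X_1,\dots,X_n$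 are i.i.d. and $Y_i=\mathbf T_i(X_i)$ are generated independently, $$\mathbb P_{(X_1,\dots,X_n)\sim p^{\otimes n}}(\phi(Y_1,\dots,Y_n)\ne p)+\mathbb P_{(X_1,\dots,X_n)\sim q^{\otimes n}}(\phi(Y_1,\dots,Y_n)\ne q)\le 0.1.$$ $n^*(p,q)$ is the same quantity with no privacy constraint (all channels allowed, $\epsilon=\infty$). A channel $\mathbf T$ achieves a sample complexity if the inequality $\mathbb P_{(X_1,\dots,X_n)\sim p^{\otimes n}}(\phi(Y_1,\dots,Y_n)\ne p)+\mathbb P_{(X_1,\dots,X_n)\sim q^{\otimes n}}(\phi(Y_1,\dots,Y_n)\ne q)\le 0.1$ holds for some test $\phi$ with $\mathbf T_i=\mathbf T$ for all $i$ and $n$ within a universal constant factor of it.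
   Formalization: For p ≠ q, the condition on ε is read as e^ε ≳ max(1, (1/d_h²) log(1/d_h²)), since for disjoint supports ε = 0 would otherwise be allowed, and the domain size is max(2, ⌈log n*(p,q)⌉), since ⌈log n*⌉ is 0 or 1 for n* ≤ 2. *)

(* Defs.v *)
From HB Require Import structures.
From mathcomp Require Import all_boot all_order all_algebra.
From mathcomp Require Import all_classical all_reals all_analysis.
Set Implicit Arguments.
Unset Strict Implicit.
Unset Printing Implicit Defensive.
Import Order.TTheory GRing.Theory Num.Theory.
Local Open Scope classical_set_scope.
Local Open Scope ring_scope.

Definition is_distr (R : realType) (X : finType) (p : {ffun X -> R}) : Prop :=
  (forall x, 0 <= p x) /\ \sum_(x : X) p x = 1.

Definition hellinger2 (R : realType) (X : finType) (p q : {ffun X -> R}) : R :=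
  \sum_(x : X) (Num.sqrt (p x) - Num.sqrt (q x)) ^+ 2.

(* [T x y] is P(Y = y | X = x): the input comes first, so the paper's
   T(y, x) is [T x y] here. *)
Record channel (R : realType) (X : finType) (Y : countType) := Channel {
  kern :> X -> Y -> R;
  kern_ge0 : forall x y, 0 <= kern x y;
  kern_sum1 : forall x, \esum_(y in [set: Y]) (kern x y)%:E = 1%E }.

Definition LDP (R : realType) (X : finType) (Y : countType) (eps : R)
    (T : channel R X Y) : Prop :=
  forall x x' y, T x y <= expR eps * T x' y.

(* P((Y_1, ..., Y_n) \in A) when X_1, ..., X_n are i.i.d. of law p and, given
   the X_i, the Y_i = T_i(X_i) are independent. *)
Definition output_prob (R : realType) (X : finType) (Y : countType) (n : nat)
    (p : {ffun X -> R}) (T : 'I_n -> channel R X Y)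
    (A : set {ffun 'I_n -> Y}) : \bar R :=
  \esum_(y in A)
    (\sum_(x : {ffun 'I_n -> X})
       (\prod_(i < n) p (x i)) * (\prod_(i < n) T i (x i) (y i)))%:E.

(* A test answers [true] for "p" and [false] for "q". *)
Definition test_succeeds (R : realType) (X : finType) (Y : countType) (n : nat)
    (p q : {ffun X -> R}) (T : 'I_n -> channel R X Y)
    (phi : {ffun 'I_n -> Y} -> bool) : Prop :=
  (output_prob p T [set y | phi y <> true]
   + output_prob q T [set y | phi y <> false] <= (10^-1 : R)%:E)%E.

Definition testable (R : realType) (X : finType) (p q : {ffun X -> R})
    (allowed : channel R X nat -> Prop) (n : nat) : Prop :=
  exists T : 'I_n -> channel R X nat, (forall i, allowed (T i)) /\
  exists phi : {ffun 'I_n -> nat} -> bool, test_succeeds p q T phi.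

Definition is_least (P : nat -> Prop) (n : nat) : Prop :=
  P n /\ forall m, P m -> (n <= m)%N.

(* n = n*(p, q, eps) *)
Definition private_sample_complexity (R : realType) (X : finType)
    (p q : {ffun X -> R}) (eps : R) (n : nat) : Prop :=
  is_least (testable p q (fun T => LDP eps T)) n.

(* n = n*(p, q) *)
Definition sample_complexity (R : realType) (X : finType)
    (p q : {ffun X -> R}) (n : nat) : Prop :=
  is_least (testable p q (fun=> True)) n.

Definition within_factor (R : realType) (c : R) (m n : nat) : Prop :=
  m%:R <= c * n%:R /\ n%:R <= c * m%:R.

Definition achieves (R : realType) (X : finType) (Y : countType)
    (p q : {ffun X -> R}) (T : channel R X Y) (c : R) (N : nat) : Prop :=
  exists n : nat, within_factor c n N /\
  exists phi : {ffun 'I_n -> Y} -> bool, test_succeeds p q (fun=> T) phi.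

(* (1/h) log(1/h), bounded below by 1.  The bound is active only for
   h > 0.567...; there (1/h) log(1/h) tends to 0 and then becomes negative, so
   that without the bound even eps = 0 would be allowed for h >= 1. *)
Definition privacy_level (R : realType) (h : R) : R :=
  Num.max 1 (h^-1 * ln h^-1).

(* ceil(log n), bounded below by 2: a channel with at most one output symbol
   carries no information, whereas ceil(log n) <= 1 for n <= 2. *)
Definition domain_size (R : realType) (n : nat) : nat :=
  maxn 2 `|Num.ceil (ln (n%:R : R))|%N.

(* Real RAM: an index memory of natural numbers and a memory of exact real
   numbers, both with indirect addressing.  Index arithmetic has no
   multiplication and reals cannot be rounded to indices, which excludes the
   usual ways of hiding long computations in unit-cost operations.  The only
   constants are natural numbers, so a program is a finite object. *)
Inductive iexp : Type :=
| IConst of nat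
| ILoad of iexp
| IAdd of iexp & iexp
| ISub of iexp & iexp.

Inductive rexp : Type :=
| RCast of iexp
| RLoad of iexp
| RAdd of rexp & rexp
| RSub of rexp & rexp
| RMul of rexp & rexp
| RDiv of rexp & rexp.

Inductive bexp : Type :=
| BLtI of iexp & iexp
| BLtR of rexp & rexp
| BNot of bexp
| BAnd of bexp & bexp.

Inductive cmd : Type :=
| Skip
| SetI of iexp & iexp
| SetR of iexp & rexp
| Seq of cmd & cmd
| If of bexp & cmd & cmd
| While of bexp & cmd.

Record state (R : realType) := State { imem : nat -> nat; rmem : nat -> R }.

Fixpoint ieval (R : realType) (s : state R) (e : iexp) : nat :=
  match e with
  | IConst n => n
  | ILoad a => imem s (ieval s a)
  | IAdd e1 e2 => (ieval s e1 + ieval s e2)%N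
  | ISub e1 e2 => (ieval s e1 - ieval s e2)%N
  end.

Fixpoint reval (R : realType) (s : state R) (e : rexp) : R :=
  match e with
  | RCast i => (ieval s i)%:R
  | RLoad a => rmem s (ieval s a)
  | RAdd e1 e2 => reval s e1 + reval s e2
  | RSub e1 e2 => reval s e1 - reval s e2
  | RMul e1 e2 => reval s e1 * reval s e2
  | RDiv e1 e2 => reval s e1 / reval s e2
  end.

Fixpoint beval (R : realType) (s : state R) (b : bexp) : bool :=
  match b with
  | BLtI e1 e2 => (ieval s e1 < ieval s e2)%N
  | BLtR e1 e2 => reval s e1 < reval s e2
  | BNot b1 => ~~ beval s b1
  | BAnd b1 b2 => beval s b1 && beval s b2
  end.

Definition update (A : Type) (f : nat -> A) (i : nat) (v : A) : nat -> A :=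
  fun j => if j == i then v else f j.

(* [exec c s s' t]: started in s, the command c halts in s' after t steps.
   Assignments and tests cost one step each; this is the number of arithmetic
   operations up to a constant factor depending only on the program. *)
Inductive exec (R : realType) : cmd -> state R -> state R -> nat -> Prop :=
| exec_skip s : exec Skip s s 1
| exec_seti a e s :
    exec (SetI a e) s
      (State (update (imem s) (ieval s a) (ieval s e)) (rmem s)) 1
| exec_setr a e s :
    exec (SetR a e) s
      (State (imem s) (update (rmem s) (ieval s a) (reval s e))) 1
| exec_seq c1 c2 s s1 s2 t1 t2 :
    exec c1 s s1 t1 -> exec c2 s1 s2 t2 -> exec (Seq c1 c2) s s2 (t1 + t2)
| exec_if b c1 c2 s s' t :
    exec (if beval s b then c1 else c2) s s' t -> exec (If b c1 c2) s s' t.+1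
| exec_while_false b c s :
    beval s b = false -> exec (While b c) s s 1
| exec_while_true b c s s1 s2 t1 t2 :
    beval s b = true -> exec c s s1 t1 -> exec (While b c) s1 s2 t2 ->
    exec (While b c) s s2 (t1 + t2).+1.

(* Input: k in index cell 0, then p, q and eps in the real cells 0, ..., 2k;
   all other cells hold 0. *)
Definition input (R : realType) (k : nat) (p q : {ffun 'I_k -> R}) (eps : R) :
    state R :=
  State (update (fun=> 0%N) 0%N k)
        (nth 0 ([seq p i | i <- enum 'I_k] ++ [seq q i | i <- enum 'I_k]
                ++ [:: eps])).

(* Output: index cell 1 holds the address of the transition matrix, which is
   stored as one block of k reals for each output symbol. *)
Definition outputs (R : realType) (k D : nat) (s : state R)
    (T : channel R 'I_k 'I_D) : Prop :=
  forall (x : 'I_k) (y : 'I_D), rmem s (imem s 1%N + y * k + x)%N = T x y.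

Definition computes_within (R : realType) (k D : nat) (prog : cmd)
    (p q : {ffun 'I_k -> R}) (eps : R) (T : channel R 'I_k 'I_D) (bound : R) :
    Prop :=
  exists (s : state R) (t : nat),
    [/\ exec prog (input p q eps) s t, t%:R <= bound & outputs s T].

(* Main.v *)
(* Replace the Hellinger distance h by the triangular discrimination
   D = sum (p - q)^2 / (p + q), with h <= D <= 2: it is a rational function of
   p and q, hence computable exactly on the real RAM.

   Without privacy, testing with error 1/10 forces the affinity
   (1 - h/2)^n of the n-fold products below 1/2, so n >= 1/h by Bernoulli.

   For the channel, let r = +-(p - q)/(p + q), with the sign for which the
   symbols with r > 0 carry at least half of D, and merge these symbols into
   the buckets 16^-(j+1) < r <= 16^-j for j < M; everything else goes to
   bucket M.  With 256^M >= 8/D the discarded symbols cost at most D/4, and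
   within one bucket merging costs a constant factor.  Randomized response then
   gives each output at least the mass eta = D/(512 M), which costs
   at most 2 M eta = D/256.  The minimal M satisfies 4^M < 1/D unless M = 1,
   which yields both M + 1 <= ceil(log n) and exp(-eps) <= eta.  The channel
   does not depend on eps, and the likelihood ratio test on its outputs
   succeeds with O(1/D) samples. *)
Require Import Defs.
From HB Require Import structures.
From mathcomp Require Import all_boot all_order all_algebra.
From mathcomp Require Import all_classical all_reals all_analysis.
From mathcomp Require Import zify ring lra.
Set Implicit Arguments.
Unset Strict Implicit.
Unset Printing Implicit Defensive.
Import Order.TTheory GRing.Theory Num.Theory.
Import numFieldNormedType.Exports.
Local Open Scope ring_scope.

Local Open Scope classical_set_scope.

(** * Countable sums and the lower bound on the sample complexity *)

Lemma esum_fintype (R : realType) (Z : finType) (A : set Z) (a : Z -> R) :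
  (forall z, 0 <= a z) ->
  \esum_(z in A) (a z)%:E = (\sum_(z | z \in A) a z)%:E.
Proof.
move=> a0; rewrite esum_mkcond esum_fset//; last first.
  by move=> z _; case: ifP; rewrite ?lee_fin.
  exact: finite_finset.
rewrite (fsbigE (index_enum Z)) ?index_enum_uniq//=; last first.
  by move=> z _; rewrite mem_index_enum.
rewrite -sumEFin [RHS]big_mkcond [LHS]big_mkcond/=; apply: eq_bigr => z _.
by rewrite mem_setT.
Qed.

(** [F] vanishes off the range of [G], so [A] may be replaced by the image of its preimage. This
    turns output probabilities of finite-range channels into finite sums. *)
Lemma esum_injective_image (R : realType) (Y : choiceType) (Z : finType)
    (G : Z -> Y) (A : set Y) (F : Y -> R) :
  injective G -> (forall y, 0 <= F y) -> (forall y, F y != 0 -> exists z, y = G z) ->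
  \esum_(y in A) (F y)%:E = (\sum_(z | G z \in A) F (G z))%:E.
Proof.
move=> Ginj F0 FG.
have -> : \esum_(y in A) (F y)%:E = \esum_(y in G @` (G @^-1` A)) (F y)%:E.
  rewrite esum_mkcond [RHS]esum_mkcond; apply: eq_esum => y _.
  have [->|/FG [z ->]] := eqVneq (F y) 0; first by rewrite !if_same.
  congr (if _ then _ else _); apply/idP/idP; rewrite !inE.
    by move=> Az; exists z.
  by move=> [z' Az' /Ginj <-].
rewrite esum_image; last by move=> x y _ _; exact: Ginj.
by rewrite esum_fintype.
Qed.

(** Restricting every coordinate to values below [N] gives a finite sum, which factors into a
    product of partial sums. Each partial sum tends to 1, hence so does the product, and the bound
    by [E] passes to the limit. *)
Lemma esum_prod_ge1 (R : realType) (n : nat) (f : 'I_n -> nat -> R) :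
  (forall i y, 0 <= f i y) ->
  (forall i, \esum_(y in [set: nat]) (f i y)%:E = 1%E) ->
  (1 <= \esum_(y in [set: {ffun 'I_n -> nat}]) (\prod_(i < n) f i (y i))%:E)%E.
Proof.
move=> f0 f1; set E := (X in (_ <= X)%E).
pose S i N := \sum_(j < N) f i j.
have Scvg i : S i @ \oo --> (1 : R).
  have f0' m : (0 <= m)%N -> xpredT m -> (0 <= (f i m)%:E)%E by rewrite lee_fin.
  have := is_cvg_nneseries (N := 0%N) f0'.
  move/cvg_ex => [l cl]; have := cvg_lim (@ereal_hausdorff R) cl.
  rewrite nneseries_esumT ?f1; last by move=> y; rewrite lee_fin.
  move=> le; move: cl; rewrite -le => /fine_cvg.
  rewrite (_ : fine \o _ = S i)//; apply/funext => N /=.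
  by rewrite sumEFin /S big_mkord.
have Pcvg : (\prod_(i < n) S i N) @[N --> \oo] --> (1 : R).
  have {2}<- : \prod_(i < n) (1 : R) = 1 by rewrite big1_eq.
  apply: cvg_big => [|i _]; last exact: Scvg.
  exact: mul_continuous.
have ub N : ((\prod_(i < n) S i N)%:E <= E)%E.
  rewrite /S bigA_distr_bigA/=.
  pose G (z : {ffun 'I_n -> 'I_N}) : {ffun 'I_n -> nat} := [ffun i => val (z i)].
  have Ginj : injective G.
    move=> z z' /ffunP zz'; apply/ffunP => i; apply: val_inj.
    by have := zz' i; rewrite !ffunE.
  pose F y := \prod_(i < n) f i (y i).
  have -> : (\sum_(z : {ffun 'I_n -> 'I_N}) \prod_i f i (z i))%:E =
      \esum_(y in range G) (F y)%:E.
    rewrite esum_image; last by move=> x y _ _; exact: Ginj.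
    rewrite esum_fintype; last by move=> z; exact: prodr_ge0.
    congr (_%:E); apply: eq_big => z; first by rewrite in_setT.
    by move=> _; apply: eq_bigr => i _; rewrite ffunE.
  rewrite esum_mkcond; apply: le_esum => y _; case: ifP => // _.
  by rewrite lee_fin prodr_ge0.
have Pcvg' : (\prod_(i < n) S i N)%:E @[N --> \oo] --> (1 : R)%:E.
  by apply: cvg_EFin => //; apply: nearW.
rewrite -(cvg_lim (@ereal_hausdorff R) Pcvg'); apply: lime_le.
  exact: (cvgP _ Pcvg').
exact: nearW.
Qed.

Lemma esumZl (R : realType) (Y : choiceType) (A : set Y) (r : R) (f : Y -> R) :
  0 <= r ->
  \esum_(y in A) (r * f y)%:E = (r%:E * \esum_(y in A) (f y)%:E)%E.
Proof.
move=> r0; rewrite /esum -ereal_supZl//; last first.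
  by apply/set0P; exists (\sum_(y \in set0) (f y)%:E)%E, set0 => //; exact: fsets_set0.
rewrite image_comp; congr ereal_sup; apply: eq_imagel => S [finS _] /=.
by rewrite !fsumEFin// -EFinM mulr_fsumr.
Qed.

(** * Lower bound through the Hellinger affinity *)

Section LowerBound.
Variables (R : realType) (X : finType).
Implicit Types p q : {ffun X -> R}.

Lemma affinity_hellinger p q : is_distr p -> is_distr q ->
  \sum_x Num.sqrt (p x * q x) = 1 - hellinger2 p q / 2.
Proof.
move=> [p0 p1] [q0 q1].
have -> : hellinger2 p q = 2 - 2 * \sum_x Num.sqrt (p x * q x).
  rewrite /hellinger2 mulr_sumr.
  transitivity (\sum_x (p x + q x - 2 * Num.sqrt (p x * q x))).
    apply: eq_bigr => x _; rewrite sqrrB !sqr_sqrtr// sqrtrM//; ring.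
  by rewrite sumrB big_split/= p1 q1.
by field.
Qed.

Lemma sqrt_prod (n : nat) (a : 'I_n -> R) : (forall i, 0 <= a i) ->
  Num.sqrt (\prod_(i < n) a i) = \prod_(i < n) Num.sqrt (a i).
Proof.
move=> a0; suff [] : Num.sqrt (\prod_(i < n) a i) = \prod_(i < n) Num.sqrt (a i)
  /\ 0 <= \prod_(i < n) a i by [].
elim/big_rec2: _ => [|i y1 y2 _ [<- y20]]; first by rewrite sqrtr1.
by rewrite sqrtrM// mulr_ge0.
Qed.

(** Tensorization of the Bhattacharyya coefficient. It serves the lower bound, applied to the
    inputs, and the error of the likelihood test, applied to the outputs. *)
Lemma affinity_prod n (P Q : X -> R) :
  (forall x, 0 <= P x) -> (forall x, 0 <= Q x) ->
  \sum_(x : {ffun 'I_n -> X})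
    Num.sqrt ((\prod_(i < n) P (x i)) * (\prod_(i < n) Q (x i))) =
  (\sum_x Num.sqrt (P x * Q x)) ^+ n.
Proof.
move=> P0 Q0.
transitivity (\prod_(i < n) \sum_x Num.sqrt (P x * Q x)); last first.
  by rewrite prodr_const card_ord.
rewrite bigA_distr_bigA/=.
apply: eq_bigr => x _; rewrite -big_split/= sqrt_prod// => i.
exact: mulr_ge0.
Qed.

(* AM-GM for [4 min(u, v)] and [max(u, v) / 4]. *)
Lemma sqrt_mul_le_min (u v : R) : 0 <= u -> 0 <= v ->
  Num.sqrt (u * v) <= 2 * Num.min u v + (u + v) / 8.
Proof.
move=> u0 v0; rewrite -(ler_pXn2r (n := 2)) ?nnegrE ?sqrtr_ge0//; last first.
  by case: (lerP u v) => _; lra.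
rewrite sqr_sqrtr ?mulr_ge0//.
have := sqr_ge0 (v - 15 * u); have := sqr_ge0 (u - 15 * v).
have := sqr_ge0 u; have := sqr_ge0 v.
by case: (lerP u v) => uv; nra.
Qed.

Lemma sum_prod_distr n p : is_distr p ->
  \sum_(x : {ffun 'I_n -> X}) \prod_(i < n) p (x i) = 1.
Proof.
move=> [_ p1]; rewrite -(bigA_distr_bigA (fun (i : 'I_n) x => p x)).
by apply: big1.
Qed.

Lemma bernoulli (x : R) n : 0 <= x <= 1 -> 1 - n%:R * x <= (1 - x) ^+ n.
Proof.
move=> /andP[x0 x1]; elim: n => [|n IH]; first by rewrite mul0r subr0.
rewrite exprS; apply: (@le_trans _ _ ((1 - x) * (1 - n%:R * x))).
  by rewrite -natr1; have : 0 <= n%:R :> R by []; nra.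
by rewrite ler_wpM2l// subr_ge0.
Qed.

Lemma output_prob_ge n p (m : {ffun 'I_n -> X} -> R)
    (T : 'I_n -> channel R X nat) (A : set {ffun 'I_n -> nat}) :
  (forall x, m x <= \prod_(i < n) p (x i)) ->
  (\esum_(y in A) (\sum_(x : {ffun 'I_n -> X})
     m x * \prod_(i < n) T i (x i) (y i))%:E <= output_prob p T A)%E.
Proof.
move=> mp; apply: le_esum => y _; rewrite lee_fin; apply: ler_sum => x _.
by rewrite ler_wpM2r// prodr_ge0// => i _; exact: kern_ge0.
Qed.

(** Send the measure [m = min(p^n, q^n)] through the channels. Every output [y] is an error under
    one of the two hypotheses, and either law gives it at least the mass [W y], so the total error
    is at least the total mass of [W], which is at least that of [m]. *)
Lemma testable_min_le p q (n : nat) (T : 'I_n -> channel R X nat) phi :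
  is_distr p -> is_distr q -> test_succeeds p q T phi ->
  \sum_(x : {ffun 'I_n -> X})
    Num.min (\prod_(i < n) p (x i)) (\prod_(i < n) q (x i)) <= 10^-1.
Proof.
move=> [p0 p1] [q0 q1]; rewrite /test_succeeds => succ.
set m := fun x : {ffun 'I_n -> X} =>
  Num.min (\prod_(i < n) p (x i)) (\prod_(i < n) q (x i)).
have m0 x : 0 <= m x by rewrite le_min !prodr_ge0.
pose W (y : {ffun 'I_n -> nat}) :=
  \sum_(x : {ffun 'I_n -> X}) m x * \prod_(i < n) T i (x i) (y i).
have W0 (x : {ffun 'I_n -> X}) (y : {ffun 'I_n -> nat}) :
    0 <= m x * \prod_(i < n) T i (x i) (y i).
  by rewrite mulr_ge0// prodr_ge0// => i _; exact: kern_ge0.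
rewrite -lee_fin; apply: le_trans succ.
apply: (@le_trans _ _ (\esum_(y in [set: {ffun 'I_n -> nat}]) (W y)%:E)).
  under eq_esum do rewrite -sumEFin.
  rewrite esum_sum; last by move=> y x _ _; rewrite lee_fin.
  rewrite -sumEFin; apply: lee_sum => x _.
  rewrite esumZl// -[leLHS]mule1; apply: lee_wpmul2l; first by rewrite lee_fin m0.
  apply: (@esum_prod_ge1 _ _ (fun i => T i (x i))) => [i y|i]; first exact: kern_ge0.
  exact: kern_sum1.
rewrite (esumID [set y | phi y <> true]); last first.
  by move=> y _; rewrite lee_fin sumr_ge0.
rewrite !setTI leeD//.
  by apply: output_prob_ge => x; rewrite ge_min lexx.
rewrite [X in \esum_(y in X) _](_ : _ = [set y | phi y <> false]).
  by apply: output_prob_ge => x; rewrite ge_min lexx orbT.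
apply/seteqP; split=> y /=; case: (phi y) => //.
by move=> _; apply.
Qed.

Lemma hellinger2_ge0 p q : 0 <= hellinger2 p q.
Proof. by apply: sumr_ge0 => x _; exact: sqr_ge0. Qed.

(** The product affinity is at most [2 * 1/10 + 2/8 <= 1/2] by [sqrt_mul_le_min], and at least
    [1 - n h / 2] by Bernoulli. *)
Lemma testable_lower_bound p q allowed n : is_distr p -> is_distr q ->
  testable p q allowed n -> 1 <= n%:R * hellinger2 p q.
Proof.
move=> dp dq [T [_ [phi succ]]].
have := testable_min_le dp dq succ.
set S := \sum_x _ => S10.
have : (1 - hellinger2 p q / 2) ^+ n <= 2^-1.
  rewrite -affinity_hellinger// -(affinity_prod n dp.1 dq.1).
  apply: (@le_trans _ _ (\sum_(x : {ffun 'I_n -> X})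
    (2 * Num.min (\prod_(i < n) p (x i)) (\prod_(i < n) q (x i))
     + (\prod_(i < n) p (x i) + \prod_(i < n) q (x i)) / 8))).
    apply: ler_sum => x _; apply: sqrt_mul_le_min; apply: prodr_ge0 => i _.
      exact: dp.1.
    exact: dq.1.
  rewrite big_split/= -mulr_sumr -mulr_suml big_split/= !sum_prod_distr//.
  by rewrite -/S; lra.
have h1 : hellinger2 p q / 2 <= 1.
  by rewrite -subr_ge0 -affinity_hellinger// sumr_ge0.
have h0 := hellinger2_ge0 p q.
have := @bernoulli (hellinger2 p q / 2) n; rewrite h1 divr_ge0// => /(_ isT).
by lra.
Qed.

End LowerBound.

(** * Channels with finite range and the likelihood ratio test *)

Section Pushforward.
Variables (R : realType) (X Z : finType) (Y : countType).
Variables (K : X -> Z -> R) (g : Z -> Y).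
Hypothesis K_ge0 : forall x z, 0 <= K x z.
Hypothesis K_sum1 : forall x, \sum_z K x z = 1.
Hypothesis g_inj : injective g.
Implicit Types p q : {ffun X -> R}.

(** A kernel with finite range is transported along an injection, so that one quantizer yields both
    a channel to [nat] and a channel to the small domain. *)
Definition push_kern x y := \sum_(z | g z == y) K x z.

Lemma push_kernE x z : push_kern x (g z) = K x z.
Proof.
by rewrite /push_kern (eq_bigl (pred1 z)) ?big_pred1_eq// => z'; rewrite (inj_eq g_inj).
Qed.

Lemma push_kern_ge0 x y : 0 <= push_kern x y.
Proof. exact: sumr_ge0. Qed.

Lemma push_kern_neq0 x y : push_kern x y != 0 -> exists z, y = g z.
Proof.
apply: contraNP => yg; apply/eqP; apply: big1 => z /eqP gz.
by case: yg; exists z.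
Qed.

Lemma push_kern_sum1 x : \esum_(y in [set: Y]) (push_kern x y)%:E = 1%E.
Proof.
rewrite (esum_injective_image _ g_inj (push_kern_ge0 x) (@push_kern_neq0 x)).
rewrite -[in RHS](K_sum1 x); congr (_%:E); apply: eq_big => z.
  by rewrite in_setT.
by rewrite push_kernE.
Qed.

Definition push_channel : channel R X Y := Channel push_kern_ge0 push_kern_sum1.

Definition out_law p z := \sum_x p x * K x z.

Lemma out_law_ge0 p z : (forall x, 0 <= p x) -> 0 <= out_law p z.
Proof. by move=> p0; apply: sumr_ge0 => x _; rewrite mulr_ge0. Qed.

(** The outputs are i.i.d. of law [out_law p]: a tuple with a coordinate outside the range of [g]
    has probability 0, and on the others the sum over inputs factors by distributivity. *)
Lemma output_prob_push n p (A : set {ffun 'I_n -> Y}) : (forall x, 0 <= p x) ->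
  output_prob p (fun=> push_channel) A =
  (\sum_(z : {ffun 'I_n -> Z} | [ffun i => g (z i)] \in A)
     \prod_(i < n) out_law p (z i))%:E.
Proof.
move=> p0; rewrite /output_prob.
pose F (y : {ffun 'I_n -> Y}) := \sum_(x : {ffun 'I_n -> X})
       (\prod_(i < n) p (x i)) * (\prod_(i < n) push_kern (x i) (y i)).
pose G (z : {ffun 'I_n -> Z}) : {ffun 'I_n -> Y} := [ffun i => g (z i)].
rewrite -[LHS]/(\esum_(y in A) (F y)%:E) (@esum_injective_image _ _ _ G).
- congr (_%:E); apply: eq_bigr => z _.
  rewrite /F /out_law bigA_distr_bigA/=; apply: eq_bigr => x _.
  rewrite -big_split/=; apply: eq_bigr => i _.
  by rewrite ffunE push_kernE.
- move=> z z' /ffunP zz'; apply/ffunP => i; apply: g_inj.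
  by have := zz' i; rewrite !ffunE.
- move=> y; apply: sumr_ge0 => x _; rewrite mulr_ge0// prodr_ge0// => i _.
  exact: push_kern_ge0.
- move=> y Fy.
  have yg i : exists z, y i == g z.
    apply: contrapT => Nyi; move/eqP: Fy; apply; apply: big1 => x _.
    apply/eqP; rewrite mulf_eq0; apply/orP; right; apply/prodf_eq0; exists i => //.
    by apply: contra_notT Nyi => /push_kern_neq0 [z ->]; exists z.
  exists [ffun i => xchoose (yg i)]; apply/ffunP => i.
  by rewrite !ffunE; apply/eqP; exact: (xchooseP (yg i)).
Qed.

(** The likelihood ratio is compared with 1 without dividing; ties are answered in favour of [p]. *)
Definition likelihood_test n p q (y : {ffun 'I_n -> Y}) : bool :=
  \prod_(i < n) \sum_x q x * push_kern x (y i) <=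
  \prod_(i < n) \sum_x p x * push_kern x (y i).

(** Each [z] contributes to exactly one of the two errors, and it contributes the smaller of its two
    likelihoods, which is at most their geometric mean. Summing gives the product affinity. *)
Lemma likelihood_test_succeeds n p q :
  (forall x, 0 <= p x) -> (forall x, 0 <= q x) ->
  (\sum_z Num.sqrt (out_law p z * out_law q z)) ^+ n <= 10^-1 ->
  test_succeeds p q (fun=> push_channel) (@likelihood_test n p q).
Proof.
move=> p0 q0 small; rewrite /test_succeeds !output_prob_push// -EFinD lee_fin.
have P0 := @out_law_ge0 p ^~ p0; have Q0 := @out_law_ge0 q ^~ q0.
apply: le_trans small; rewrite -affinity_prod//.
have lrE (z : {ffun 'I_n -> Z}) : likelihood_test p q [ffun i => g (z i)] =
    (\prod_(i < n) out_law q (z i) <= \prod_(i < n) out_law p (z i)).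
  by rewrite /likelihood_test; congr (_ <= _); apply: eq_bigr => i _;
    apply: eq_bigr => x _; rewrite ffunE push_kernE.
rewrite [X in X + _]big_mkcond [X in _ + X]big_mkcond -big_split/=.
apply: ler_sum => z _.
have Pz : 0 <= \prod_(i < n) out_law p (z i) by rewrite prodr_ge0.
have Qz : 0 <= \prod_(i < n) out_law q (z i) by rewrite prodr_ge0.
have sqrt_ge (u v : R) : 0 <= u -> u <= v -> u <= Num.sqrt (u * v).
  move=> u0 uv; rewrite -[leLHS]ger0_norm// -sqrtr_sqr ler_wsqrtr//.
  by rewrite expr2 ler_wpM2l.
have [qp|pq] := lerP (\prod_(i < n) out_law q (z i)) (\prod_(i < n) out_law p (z i)).
  rewrite ifF; last by apply/negP; rewrite inE/= lrE qp; case.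
  rewrite add0r ifT; last by rewrite inE/= lrE qp.
  by rewrite mulrC sqrt_ge.
rewrite [X in _ + X]ifF; last by apply/negP; rewrite inE/= lrE leNgt pq; case.
rewrite addr0 ifT; last by rewrite inE/= lrE leNgt pq.
by rewrite sqrt_ge// ltW.
Qed.

Lemma push_channel_LDP eps :
  (forall x x' z, K x z <= expR eps * K x' z) -> LDP eps push_channel.
Proof.
move=> KLDP x x' y /=; rewrite /push_kern mulr_sumr.
by apply: ler_sum => z _; exact: KLDP.
Qed.

End Pushforward.

(** * The channel *)

Section Entries.
Variable R : realType.
Implicit Types u v s E : R.

(** The form matches the expression evaluated by the program. For [u = v = 0], division by zero
    gives the intended value 0. *)
Definition triangular u v : R := (u - v) * (u - v) / (u + v).

Definition signed_triangular u v : R :=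
  if v < u then triangular u v else - triangular u v.

Definition level y : R := 16^-1 ^+ y.

(** With [r = s (u - v) / (u + v)] this is [r > 16^-y], cleared of the denominator. *)
Definition exceeds y s u v := level y * (u + v) < s * (u - v).

(** For [y < M] this is [16^-(y+1) < r <= 16^-y]. The bucket [y = M] has no lower end and also
    collects the negative ratios. *)
Definition in_bucket M y s u v :=
  ~~ exceeds y s u v && ~~ ((y < M)%N && ~~ exceeds y.+1 s u v).

Definition entry M s E y u v :=
  if in_bucket M y s u v then 1 - E * M%:R else E.

Lemma level_gt0 y : 0 < level y.
Proof. by rewrite exprn_gt0. Qed.

Lemma levelS y : level y = 16 * level y.+1.
Proof. by rewrite /level exprS; field. Qed.

Lemma level_le1 y : level y <= 1.
Proof. by rewrite exprn_ile1 ?invr_ge0 ?invf_le1 ?ler1n ?ltr0n. Qed.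

Lemma sqr_level y : level y ^+ 2 = (256 ^+ y)^-1.
Proof.
rewrite /level -exprM mulnC exprM exprVn -[RHS]exprVn.
by congr (_^-1 ^+ y); ring.
Qed.

Lemma triangular_ge0 u v : 0 <= u -> 0 <= v -> 0 <= triangular u v.
Proof. by move=> u0 v0; rewrite divr_ge0 ?addr_ge0// -expr2 sqr_ge0. Qed.

Lemma triangular_le u v : 0 <= u -> 0 <= v -> triangular u v <= u + v.
Proof.
move=> u0 v0; rewrite /triangular.
have [->|w0] := eqVneq (u + v) 0; first by rewrite invr0 mulr0.
rewrite ler_pdivrMr; first by nra.
by rewrite lt_neqAle eq_sym w0 addr_ge0.
Qed.

(** With [a], [b] the square roots, [u - v = (a - b)(a + b)] and
    [u + v = a^2 + b^2 <= (a + b)^2]. *)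
Lemma hellinger_term_le_triangular u v : 0 <= u -> 0 <= v ->
  (Num.sqrt u - Num.sqrt v) ^+ 2 <= triangular u v.
Proof.
move=> u0 v0; rewrite /triangular.
have := sqr_sqrtr u0; have := sqr_sqrtr v0.
have := sqrtr_ge0 u; have := sqrtr_ge0 v.
set a := Num.sqrt u; set b := Num.sqrt v => b0 a0 bv au.
have [w0|w0] := eqVneq (u + v) 0.
  have -> : a = 0 by apply/eqP; rewrite -sqrf_eq0 au; apply/eqP; lra.
  have -> : b = 0 by apply/eqP; rewrite -sqrf_eq0 bv; apply/eqP; lra.
  by rewrite w0 invr0 mulr0 subr0 expr0n.
rewrite ler_pdivlMr; last by rewrite lt_neqAle eq_sym w0 addr_ge0.
rewrite -au -bv.
have -> : (a ^+ 2 - b ^+ 2) * (a ^+ 2 - b ^+ 2) = (a - b) ^+ 2 * (a + b) ^+ 2 by ring.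
by rewrite ler_wpM2l ?sqr_ge0//; nra.
Qed.

(* With [a = sqrt u] and [b = sqrt v], the difference of the two sides is at
   least [(a - b - mu (a + b) / 2) ^ 2 / 2]. *)
Lemma sqrt_mul_le_tangent u v mu : 0 <= u -> 0 <= v ->
  Num.sqrt (u * v) <=
  (u + v) / 2 - (2 * mu * (u - v) - mu ^+ 2 * (u + v)) / 4.
Proof.
move=> u0 v0; rewrite sqrtrM//.
have := sqr_sqrtr u0; have := sqr_sqrtr v0.
set a := Num.sqrt u; set b := Num.sqrt v => <- <-.
have := sqr_ge0 (a - b - mu * (a + b) / 2); have := sqr_ge0 (mu * (a - b)).
nra.
Qed.

Lemma exceeds_level0 s u v : 0 <= u -> 0 <= v -> `|s| <= 1 -> exceeds 0 s u v = false.
Proof.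
move=> u0 v0; rewrite ler_norml => /andP[s1 s2].
apply/negbTE; rewrite /exceeds -leNgt /level expr0 mul1r.
have : 0 <= (1 - s) * u by rewrite mulr_ge0// subr_ge0.
have : 0 <= (1 + s) * v by rewrite mulr_ge0//; lra.
lra.
Qed.

Lemma exceedsS y s u v : 0 <= u -> 0 <= v -> exceeds y s u v -> exceeds y.+1 s u v.
Proof.
move=> u0 v0; apply: le_lt_trans; rewrite ler_wpM2r ?addr_ge0// (levelS y).
by have := level_gt0 y.+1; lra.
Qed.

(** The conditions [r > 16^-y] are nested in [y] and the one for [y = 0] is never met, so the bucket
    indicators telescope. *)
Lemma sum_in_bucket_lt M m s u v : 0 <= u -> 0 <= v -> `|s| <= 1 -> (m <= M)%N ->
  \sum_(y < m) (in_bucket M y s u v)%:R = (exceeds m s u v)%:R :> R.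
Proof.
move=> u0 v0 s1; elim: m => [|m IH] mM; first by rewrite big_ord0 exceeds_level0.
rewrite big_ord_recr/= IH 1?ltnW// /in_bucket mM/= negbK.
have := @exceedsS m s u v u0 v0.
case: (exceeds m s u v) => [->//|_]; first by rewrite addr0.
by rewrite add0r.
Qed.

Lemma sum_in_bucket M s u v : 0 <= u -> 0 <= v -> `|s| <= 1 ->
  \sum_(y < M.+1) (in_bucket M y s u v)%:R = 1 :> R.
Proof.
move=> u0 v0 s1; rewrite big_ord_recr/= sum_in_bucket_lt// /in_bucket ltnn andbT.
by case: exceeds; rewrite ?addr0 ?add0r.
Qed.

Lemma entryE M s E y u v :
  entry M s E y u v = E + (1 - E * M.+1%:R) * (in_bucket M y s u v)%:R.
Proof. by rewrite /entry; case: in_bucket; rewrite -?natr1 /=; ring. Qed.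

(** Put [w = u + v]. The bucket says [l w < d <= 16 l w]. The first inequality makes the right side
    at least [l d], the second gives [l d >= d^2 / (16 w)]. *)
Lemma bucket_gain M y s u v : 0 <= u -> 0 <= v -> s ^+ 2 = 1 -> (y < M)%N ->
  in_bucket M y s u v ->
  triangular u v / 16 <=
  2 * level y.+1 * (s * (u - v)) - level y.+1 ^+ 2 * (u + v).
Proof.
move=> u0 v0 s1 yM; rewrite /in_bucket yM/= negbK => /andP[].
rewrite /exceeds -leNgt (levelS y); set l := level y.+1; set d := s * (u - v).
have l0 : 0 < l by exact: level_gt0.
move=> dle dgt.
have w0 : 0 < u + v.
  rewrite lt_neqAle addr_ge0// andbT eq_sym; apply/eqP => w0.
  by move: dle dgt; rewrite w0 !mulr0; lra.
have -> : triangular u v = d * d / (u + v).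
  by rewrite /triangular /d; congr (_ / _); rewrite -[LHS]mul1r -s1; ring.
apply: (@le_trans _ _ (l * d)); last by nra.
rewrite mulrAC ler_pdivrMr// ler_pdivrMr//; nra.
Qed.

(** Only symbols with [0 < r <= 16^-M] are lost, and for them the triangular term [r^2 (u + v)] is
    at most [level M ^+ 2 * (u + v)]. *)
Lemma truncation_loss M s u v : 0 <= u -> 0 <= v -> s ^+ 2 = 1 ->
  (0 < s * (u - v))%R%:R * triangular u v - level M ^+ 2 * (u + v) <=
  (exceeds M s u v)%:R * triangular u v.
Proof.
move=> u0 v0 s1; have t0 := triangular_ge0 u0 v0.
have l0 := level_gt0 M.
have lw : 0 <= level M ^+ 2 * (u + v) by rewrite mulr_ge0 ?sqr_ge0 ?addr_ge0.
have [ex|nex] := boolP (exceeds M s u v).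
  by case: (0 < _); rewrite ?mul1r ?mul0r; lra.
rewrite mul0r; case: ltP => /= d0; last by rewrite mul0r; lra.
rewrite mul1r subr_le0; move: nex; rewrite /exceeds -leNgt.
have -> : triangular u v = (s * (u - v)) * (s * (u - v)) / (u + v).
  by rewrite /triangular; congr (_ / _); rewrite -[LHS]mul1r -s1; ring.
move: d0; set d := s * (u - v) => d0 dle.
have w0 : 0 < u + v.
  rewrite lt_neqAle addr_ge0// andbT eq_sym; apply/eqP => w0.
  by move: dle; rewrite w0 !mulr0; lra.
by rewrite ler_pdivrMr//; nra.
Qed.

End Entries.

(** * Noise level and affinity of the quantized laws *)

Section Quantizer.
Variables (R : realType) (X : finType) (p q : {ffun X -> R}) (M : nat).
Hypotheses (dp : is_distr p) (dq : is_distr q).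

Definition divergence : R := \sum_x triangular (p x) (q x).

Definition imbalance : R := \sum_x signed_triangular (p x) (q x).

Definition side : R := if imbalance < 0 then -1 else 1.

Definition noise : R := divergence / (512 * M%:R).

Definition quantizer (x : X) (y : 'I_M.+1) : R :=
  entry M side noise y (p x) (q x).

Hypotheses (M_gt0 : (0 < M)%N) (M_large : 8 <= 256 ^+ M * divergence).

Let p0 x : 0 <= p x := dp.1 x.
Let q0 x : 0 <= q x := dq.1 x.

Lemma divergence_ge0 : 0 <= divergence.
Proof. by apply: sumr_ge0 => x _; exact: triangular_ge0. Qed.

Lemma sum_distrD : \sum_x (p x + q x) = 2.
Proof. by rewrite big_split/= dp.2 dq.2. Qed.

Lemma divergence_le2 : divergence <= 2.
Proof. by rewrite -sum_distrD; apply: ler_sum => x _; exact: triangular_le. Qed.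

Lemma hellinger2_le_divergence : hellinger2 p q <= divergence.
Proof. by apply: ler_sum => x _; exact: hellinger_term_le_triangular. Qed.

Lemma sqr_side : side ^+ 2 = 1.
Proof. by rewrite /side; case: ifP; rewrite ?sqrrN expr1n. Qed.

Lemma norm_side : `|side| <= 1.
Proof. by rewrite /side; case: ifP; rewrite ?normrN1 ?normr1. Qed.

Lemma noise_ge0 : 0 <= noise.
Proof. by rewrite divr_ge0 ?divergence_ge0 ?mulr_ge0. Qed.

Lemma noiseM : noise * M%:R = divergence / 512.
Proof.
have : M%:R != 0 :> R by rewrite pnatr_eq0 -lt0n.
by rewrite /noise => M0; field.
Qed.

(** By [entryE] this leaves the bucket indicator a weight of at least 1/2. *)
Lemma noiseSM : noise * M.+1%:R <= 2^-1.
Proof.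
have : noise <= noise * M%:R by rewrite ler_peMr ?noise_ge0// ler1n.
by rewrite -natr1 mulrDr mulr1 noiseM; have := divergence_le2; lra.
Qed.

Lemma quantizer_ge_noise x y : noise <= quantizer x y.
Proof.
rewrite /quantizer entryE lerDl mulr_ge0// subr_ge0.
by have := noiseSM; lra.
Qed.

Lemma quantizer_ge0 x y : 0 <= quantizer x y.
Proof. exact: le_trans noise_ge0 (quantizer_ge_noise x y). Qed.

Lemma quantizer_le1 x y : quantizer x y <= 1.
Proof.
have n0 := noise_ge0; have : 0 <= noise * M%:R by rewrite mulr_ge0.
have := noiseSM; rewrite -natr1 mulrDr /quantizer/entry; case: ifP => _; lra.
Qed.

Lemma quantizer_sum1 x : \sum_y quantizer x y = 1.
Proof.
under eq_bigr do rewrite /quantizer entryE.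
rewrite big_split/= sumr_const card_ord -mulr_sumr.
by rewrite sum_in_bucket ?norm_side// -mulr_natr; ring.
Qed.

(* The side is chosen so that it carries at least half of the divergence. *)
Lemma side_divergence :
  divergence / 2 <= \sum_x (0 < side * (p x - q x))%R%:R * triangular (p x) (q x).
Proof.
(* The indicator equals [(1 + side * sign(p x - q x)) / 2] except at ties, where the triangular term
   is 0. *)
have -> : \sum_x (0 < side * (p x - q x))%R%:R * triangular (p x) (q x) =
    (divergence + side * imbalance) / 2.
  rewrite /divergence mulr_sumr -big_split/= mulr_suml; apply: eq_bigr => x _.
  rewrite /signed_triangular.
  have tpp : p x = q x -> triangular (p x) (q x) = 0.
    by move=> ->; rewrite /triangular subrr !mul0r.
  rewrite /side; case: ifP => _.
    rewrite mulN1r oppr_gt0 subr_lt0.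
    by case: ltgtP => [||e]; rewrite /= ?(tpp e) ?(tpp (esym e)) ?mul1r ?mul0r; lra.
  rewrite mul1r subr_gt0.
  by case: ltgtP => [||e]; rewrite /= ?(tpp e) ?(tpp (esym e)) ?mul1r ?mul0r; lra.
have : 0 <= side * imbalance; last by lra.
by rewrite /side; case: ltP => [/ltW|]; rewrite ?mul1r// mulN1r oppr_ge0.
Qed.

(** Half of the divergence lies on the chosen side, and truncation loses at most [2 * 256^-M], which
    is at most a quarter of it by [M_large]. *)
Lemma captured_divergence :
  divergence / 4 <= \sum_x (exceeds M side (p x) (q x))%:R * triangular (p x) (q x).
Proof.
apply: (@le_trans _ _ (\sum_x
    ((0 < side * (p x - q x))%R%:R * triangular (p x) (q x)
     - level R M ^+ 2 * (p x + q x)))); last first.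
  by apply: ler_sum => x _; apply: truncation_loss => //; exact: sqr_side.
rewrite sumrB -mulr_sumr sum_distrD.
have := side_divergence; set S := \sum_x _ => S2.
have : level R M ^+ 2 * 8 <= divergence.
  by rewrite sqr_level ler_pdivrMl ?exprn_gt0.
by lra.
Qed.

(** The noise cancels in the differences of the two laws and costs at most [2 * noise] per bucket in
    their sums, in total [divergence / 256]. The buckets gain [divergence / 64] with weight at least
    1/2, so [divergence / 256] is left. *)
Lemma quantizer_gain :
  divergence / 256 <=
  \sum_(y < M) (2 * (side * level R y.+1) *
     (out_law quantizer p (widen_ord (leqnSn M) y) -
      out_law quantizer q (widen_ord (leqnSn M) y))
     - (side * level R y.+1) ^+ 2 *
     (out_law quantizer p (widen_ord (leqnSn M) y) +
      out_law quantizer q (widen_ord (leqnSn M) y))).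
Proof.
set b := 1 - noise * M.+1%:R.
have b2 : 2^-1 <= b by have := noiseSM; rewrite /b; lra.
pose B x y : R := (in_bucket M y side (p x) (q x))%:R.
pose gain x y : R := 2 * level R y.+1 * (side * (p x - q x)) -
  level R y.+1 ^+ 2 * (p x + q x).
have outE (r : {ffun X -> R}) y : \sum_x r x = 1 ->
    out_law quantizer r (widen_ord (leqnSn M) y) = noise + b * \sum_x r x * B x y.
  move=> r1; rewrite /out_law -[X in X + _]mul1r -[X in X * _ + _]r1 mulr_suml.
  rewrite mulr_sumr -big_split/=; apply: eq_bigr => x _.
  by rewrite /quantizer entryE -/b /B /=; ring.
apply: (@le_trans _ _ (\sum_(y < M)
    (b * (\sum_x B x y * gain x y) - 2 * noise))); last first.
  apply: ler_sum => y _; rewrite !outE ?dp.2 ?dq.2//.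
  rewrite exprMn sqr_side mul1r.
  have -> : \sum_x B x y * gain x y =
      2 * (side * level R y.+1) * (\sum_x p x * B x y - \sum_x q x * B x y)
      - level R y.+1 ^+ 2 * (\sum_x p x * B x y + \sum_x q x * B x y).
    rewrite -sumrB -big_split/= !mulr_sumr -sumrB; apply: eq_bigr => x _.
    by rewrite /gain; ring.
  have : level R y.+1 ^+ 2 * noise <= noise.
    by rewrite ler_piMl ?noise_ge0// expr_le1 ?level_le1// ltW// level_gt0.
  by lra.
rewrite sumrB sumr_const card_ord -mulr_sumr -[X in _ - X]mulr_natr.
rewrite -mulrA noiseM.
(* After exchanging the sums, each symbol above the last threshold sits in exactly one of the first
   [M] buckets and gains 1/16 of its triangular term. *)
have : divergence / 64 <= \sum_(y < M) \sum_x B x y * gain x y.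
  rewrite exchange_big/=.
  apply: (@le_trans _ _ (\sum_x (exceeds M side (p x) (q x))%:R *
      (triangular (p x) (q x) / 16))).
    have := captured_divergence.
    under [X in _ -> _ <= X]eq_bigr do rewrite mulrA.
    by rewrite -mulr_suml; lra.
  apply: ler_sum => x _.
  rewrite -(sum_in_bucket_lt (p0 x) (q0 x) norm_side (leqnn M)) mulr_suml.
  apply: ler_sum => y _; rewrite /B.
  have [bxy|_] := boolP (in_bucket _ _ _ _ _); last by rewrite !mul0r.
  by rewrite !mul1r; apply: bucket_gain; rewrite ?sqr_side.
have := divergence_ge0; set S := \sum_(y < M) _ => d0 S64.
have : 2^-1 * S <= b * S by rewrite ler_wpM2r//; lra.
by lra.
Qed.

(** The tangent bound is used with slope [side * level y.+1] in bucket [y < M] and slope 0 in the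
    last one. Its factor 1/4 turns the gain into [divergence / 1024]. *)
Lemma quantizer_affinity :
  \sum_y Num.sqrt (out_law quantizer p y * out_law quantizer q y) <=
  1 - divergence / 1024.
Proof.
have P0 y := out_law_ge0 quantizer_ge0 y p0.
have Q0 y := out_law_ge0 quantizer_ge0 y q0.
have out1 (r : {ffun X -> R}) : is_distr r -> \sum_y out_law quantizer r y = 1.
  move=> [_ r1]; rewrite /out_law exchange_big/= -[RHS]r1; apply: eq_bigr => x _.
  by rewrite -mulr_sumr quantizer_sum1 mulr1.
have half : (\sum_y (out_law quantizer p y + out_law quantizer q y) / 2) = 1.
  by rewrite -mulr_suml big_split/= !out1//; field.
rewrite -[X in _ <= X - _]half.
pose mu y := side * level R y.+1.
apply: (@le_trans _ _ (\sum_(y < M.+1)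
   ((out_law quantizer p y + out_law quantizer q y) / 2
    - (if (y < M)%N then (2 * mu y * (out_law quantizer p y - out_law quantizer q y)
       - mu y ^+ 2 * (out_law quantizer p y + out_law quantizer q y)) / 4 else 0)))).
  apply: ler_sum => y _; case: ifP => _; first exact: sqrt_mul_le_tangent.
  apply: le_trans (sqrt_mul_le_tangent 0 (P0 y) (Q0 y)) _.
  by rewrite mulr0 !mul0r expr0n mul0r subrr mul0r.
rewrite sumrB lerD2l lerN2 big_ord_recr/= ltnn addr0.
under [leRHS]eq_bigr do rewrite ltn_ord.
by rewrite -mulr_suml; have := quantizer_gain; lra.
Qed.

End Quantizer.

(** * The program *)

Definition index_reg i := ILoad (IConst i).
(** Real cell [2k + 1 + i], just past the input. The address is computed at run time because the
    program may not depend on [k]; [scratch_addr 4] is where the matrix begins. *)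
Definition scratch_addr i :=
  IAdd (IAdd (index_reg 0) (index_reg 0)) (IConst i.+1).
Definition real_reg i := RLoad (scratch_addr i).
Definition p_cell := RLoad (index_reg 2).
Definition q_cell := RLoad (IAdd (index_reg 0) (index_reg 2)).
Definition incr_index i := SetI (IConst i) (IAdd (index_reg i) (IConst 1)).

Definition triangular_exp :=
  RDiv (RMul (RSub p_cell q_cell) (RSub p_cell q_cell)) (RAdd p_cell q_cell).

Definition divergence_step :=
  Seq (SetR (scratch_addr 0) (RAdd (real_reg 0) triangular_exp))
  (Seq (If (BLtR q_cell p_cell)
           (SetR (scratch_addr 1) (RAdd (real_reg 1) triangular_exp))
           (SetR (scratch_addr 1) (RSub (real_reg 1) triangular_exp)))
       (incr_index 2)).

Definition divergence_loop :=
  While (BLtI (index_reg 2) (index_reg 0)) divergence_step.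

Definition set_side :=
  If (BLtR (real_reg 1) (RCast (IConst 0)))
     (SetR (scratch_addr 1) (RSub (RCast (IConst 0)) (RCast (IConst 1))))
     (SetR (scratch_addr 1) (RCast (IConst 1))).

(** Search for the least [M >= 1] with [8 <= 256^M * divergence]. During the search the level cell
    holds [256^M * divergence]. *)
Definition depth_loop :=
  While (BLtR (real_reg 2) (RCast (IConst 8)))
    (Seq (SetR (scratch_addr 2) (RMul (real_reg 2) (RCast (IConst 256))))
         (incr_index 3)).

Definition exceeds_exp l :=
  BLtR (RMul l (RAdd p_cell q_cell)) (RMul (real_reg 1) (RSub p_cell q_cell)).

Definition in_bucket_exp :=
  BAnd (BNot (exceeds_exp (real_reg 2)))
    (BNot (BAnd (BLtI (index_reg 4) (index_reg 3))
       (BNot (exceeds_exp (RDiv (real_reg 2) (RCast (IConst 16))))))).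

Definition row_loop :=
  While (BLtI (index_reg 2) (index_reg 0))
    (Seq (If in_bucket_exp
            (SetR (index_reg 5)
               (RSub (RCast (IConst 1)) (RMul (real_reg 3) (RCast (index_reg 3)))))
            (SetR (index_reg 5) (real_reg 3)))
    (Seq (incr_index 5) (incr_index 2))).

Definition matrix_loop :=
  While (BLtI (index_reg 4) (IAdd (index_reg 3) (IConst 1)))
    (Seq (SetI (IConst 2) (IConst 0))
    (Seq row_loop
    (Seq (SetR (scratch_addr 2) (RDiv (real_reg 2) (RCast (IConst 16))))
         (incr_index 4)))).

(* Index cells: 1 = output address, 2 = x, 3 = M, 4 = y, 5 = write pointer.
   Real cells 2k+1, ..., 2k+4: divergence, imbalance (then side), level,
   noise.  The matrix is written from real cell 2k+5 on. *)
Definition program :=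
  Seq (SetI (IConst 1) (scratch_addr 4))
  (Seq (SetI (IConst 5) (scratch_addr 4))
  (Seq divergence_loop
  (Seq set_side
  (Seq (SetI (IConst 3) (IConst 1))
  (Seq (SetR (scratch_addr 2) (RMul (real_reg 0) (RCast (IConst 256))))
  (Seq depth_loop
  (Seq (SetR (scratch_addr 3)
          (RDiv (real_reg 0) (RMul (RCast (IConst 512)) (RCast (index_reg 3)))))
  (Seq (SetR (scratch_addr 2) (RCast (IConst 1)))
       matrix_loop)))))))).

(** * Execution of the loops and their step counts *)

Section Execution.
Variable R : realType.

(** The invariant is the explicit sequence [S] of states. Each round costs the body and one test,
    and the failing test costs the last step. *)
Lemma exec_while_iter (b : bexp) (c : cmd) (S : nat -> state R) n t :
  (forall i, (i < n)%N -> beval (S i) b /\ exec c (S i) (S i.+1) t) ->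
  beval (S n) b = false ->
  exec (While b c) (S 0%N) (S n) (n * t.+1).+1.
Proof.
elim: n S => [|n IH] S body stop; first exact: exec_while_false.
have [b0 c0] := body 0%N isT.
rewrite mulSn addSnnS; apply: exec_while_true b0 c0 _.
by apply: (IH (S \o succn)) => // i ltin; exact: body.
Qed.

Lemma if_SetR (b : bool) a e1 e2 :
  (if b then SetR a e1 else SetR a e2) = SetR a (if b then e1 else e2).
Proof. by case: b. Qed.

Lemma exec_if_bool (b : bool) (e : bexp) c1 c2 (s s' : state R) t :
  beval s e = b -> exec (if b then c1 else c2) s s' t ->
  exec (If e c1 c2) s s' t.+1.
Proof. by move=> <-; exact: exec_if. Qed.

Variables (k : nat) (rin : nat -> R).

(** The shape of memory throughout the run: index registers, input reals that are only read, four
    scratch reals, and an output area renumbered from 0. *)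
Definition mem (ir : seq nat) (rr : seq R) (out : nat -> R) : state R :=
  State (nth 0%N ir)
    (fun j => if (j < (k + k).+1)%N then rin j
              else if (j < (k + k).+1 + 4)%N then nth 0 rr (j - (k + k).+1)
              else out (j - ((k + k).+1 + 4))%N).

Lemma rmem_reg ir rr out i : (i < 4)%N ->
  rmem (mem ir rr out) (k + k + i.+1)%N = nth 0 rr i.
Proof.
move=> i4 /=; rewrite ifF; last lia; rewrite ifT; last lia.
by congr nth; lia.
Qed.

Lemma exec_set_index i e v ir rr out : v = ieval (mem ir rr out) e ->
  exec (SetI (IConst i) e) (mem ir rr out) (mem (set_nth 0%N ir i v) rr out) 1.
Proof.
move=> ->; have := exec_seti (IConst i) e (mem ir rr out).
congr (exec _ _ _ _); congr State; apply/funext => j.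
by rewrite nth_set_nth.
Qed.

Lemma exec_set_real i e v ir rr out : nth 0%N ir 0 = k -> (i < 4)%N ->
  v = reval (mem ir rr out) e ->
  exec (SetR (scratch_addr i) e) (mem ir rr out) (mem ir (set_nth 0 rr i v) out) 1.
Proof.
move=> irk i4 ->; have := exec_setr (scratch_addr i) e (mem ir rr out).
congr (exec _ _ _ _); congr State; apply/funext => j.
rewrite /update /= irk nth_set_nth/=.
have [->|ji] := eqVneq j (k + k + i.+1)%N.
  by rewrite ifF; last lia; rewrite ifT; last lia; rewrite ifT//; lia.
case: ifP => // j1; case: ifP => // j2; rewrite ifF//; lia.
Qed.

Lemma exec_set_out e v t ir rr out :
  nth 0%N ir 5 = ((k + k).+1 + 4 + t)%N -> v = reval (mem ir rr out) e ->
  exec (SetR (index_reg 5) e) (mem ir rr out) (mem ir rr (update out t v)) 1.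
Proof.
move=> irt ->; have := exec_setr (index_reg 5) e (mem ir rr out).
congr (exec _ _ _ _); congr State; apply/funext => j.
rewrite /update /= irt.
have [->|jt] := eqVneq j ((k + k).+1 + 4 + t)%N.
  by rewrite ifF; last lia; rewrite ifF; last lia; rewrite ifT//; lia.
case: ifP => // j1; case: ifP => // j2; rewrite ifF//; lia.
Qed.

Lemma eval_p ir rr out x : nth 0%N ir 0 = k -> nth 0%N ir 2 = x -> (x < k)%N ->
  reval (mem ir rr out) p_cell = rin x.
Proof. by move=> irk irx xk; rewrite /= irx ifT//; lia. Qed.

Lemma eval_q ir rr out x : nth 0%N ir 0 = k -> nth 0%N ir 2 = x -> (x < k)%N ->
  reval (mem ir rr out) q_cell = rin (k + x)%N.
Proof. by move=> irk irx xk; rewrite /= irx irk ifT//; lia. Qed.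

Lemma eval_real_reg ir rr out i : nth 0%N ir 0 = k -> (i < 4)%N ->
  reval (mem ir rr out) (real_reg i) = nth 0 rr i.
Proof. by move=> irk i4; rewrite -(rmem_reg ir rr out i4) /= irk. Qed.

Let tri j := triangular (rin j) (rin (k + j)).
Let signed_tri j := signed_triangular (rin j) (rin (k + j)).

Lemma exec_divergence_loop b t :
  exec divergence_loop (mem [:: k; b; 0; 0; 0; t]%N [:: 0; 0; 0; 0] (fun=> 0))
    (mem [:: k; b; k; 0; 0; t]%N
       [:: \sum_(j < k) tri j; \sum_(j < k) signed_tri j; 0; 0] (fun=> 0))
    (k * 5).+1.
Proof.
pose S x := mem [:: k; b; x; 0; 0; t]%N
  [:: \sum_(j < x) tri j; \sum_(j < x) signed_tri j; 0; 0] (fun=> 0).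
have -> : mem [:: k; b; 0; 0; 0; t]%N [:: 0; 0; 0; 0] (fun=> 0) = S 0%N.
  by rewrite /S !big_ord0.
apply: (exec_while_iter (S := S)) => [x xk|]; last by rewrite /= ltnn.
split; first by [].
have triE rr out : reval (mem [:: k; b; x; 0; 0; t]%N rr out) triangular_exp = tri x.
  rewrite /triangular_exp /tri /triangular.
  rewrite -(@eval_p [:: k; b; x; 0; 0; t]%N rr out)//.
  by rewrite -(@eval_q [:: k; b; x; 0; 0; t]%N rr out x).
rewrite -[4%N]/(1 + (2 + 1))%N.
apply: exec_seq.
  apply: (@exec_set_real _ _ (\sum_(j < x) tri j + tri x)) => //.
  by rewrite -[RHS]/(reval _ (real_reg 0) + reval _ triangular_exp) triE eval_real_reg.
apply: exec_seq.
  apply: (@exec_if_bool (rin (k + x) < rin x)).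
    by rewrite /beval (@eval_p _ _ _ x)// (@eval_q _ _ _ x).
  rewrite if_SetR.
  apply: (@exec_set_real _ _ (\sum_(j < x) signed_tri j + signed_tri x)) => //.
  rewrite /signed_tri /signed_triangular; case: ifP => _.
    by rewrite -[RHS]/(reval _ (real_reg 1) + reval _ triangular_exp) triE eval_real_reg.
  by rewrite -[RHS]/(reval _ (real_reg 1) - reval _ triangular_exp) triE eval_real_reg.
rewrite /S !big_ord_recr/=.
have -> : [:: k; b; x.+1; 0; 0; t]%N = set_nth 0%N [:: k; b; x; 0; 0; t]%N 2 (x + 1)%N.
  by rewrite addn1.
exact: exec_set_index.
Qed.

Lemma exec_set_side b t D V : exec set_side
  (mem [:: k; b; k; 0; 0; t]%N [:: D; V; 0; 0] (fun=> 0))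
  (mem [:: k; b; k; 0; 0; t]%N [:: D; if V < 0 then -1 else 1; 0; 0] (fun=> 0)) 2.
Proof.
apply: (@exec_if_bool (V < 0)).
  by rewrite /beval eval_real_reg.
rewrite if_SetR; apply: (@exec_set_real _ _ (if V < 0 then -1 else 1)) => //.
by case: ifP => //= _; rewrite sub0r.
Qed.

Lemma exec_depth_loop b t D s M : (0 < M)%N ->
  (forall m, (0 < m < M)%N -> 256 ^+ m * D < 8) -> 8 <= 256 ^+ M * D ->
  exec depth_loop
    (mem [:: k; b; k; 1; 0; t]%N [:: D; s; D * 256; 0] (fun=> 0))
    (mem [:: k; b; k; M; 0; t]%N [:: D; s; 256 ^+ M * D; 0] (fun=> 0))
    (M.-1 * 3).+1.
Proof.
case: M => // M _ lt8 ge8 /=.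
(* Shifted by one, since the search starts at depth 1. *)
pose S m := mem [:: k; b; k; m.+1; 0; t]%N [:: D; s; 256 ^+ m.+1 * D; 0] (fun=> 0).
have -> : mem [:: k; b; k; 1; 0; t]%N [:: D; s; D * 256; 0] (fun=> 0) = S 0%N.
  by rewrite /S expr1 mulrC.
apply: (exec_while_iter (S := S)) => [m mM|]; last first.
  by rewrite /beval eval_real_reg//= ltNge ge8.
split; first by rewrite /beval eval_real_reg//= lt8.
apply: (@exec_seq _ _ _ _ _ _ 1 1).
  apply: (@exec_set_real _ _ (256 ^+ m.+2 * D)) => //.
  rewrite -[RHS]/(reval _ (real_reg 2) * 256) eval_real_reg//=.
  by rewrite [in LHS]exprSr; ring.
have -> : S m.+1 = mem (set_nth 0%N [:: k; b; k; m.+1; 0; t]%N 3 (m.+1 + 1)%N)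
    [:: D; s; 256 ^+ m.+2 * D; 0] (fun=> 0).
  by rewrite /S addn1.
exact: exec_set_index.
Qed.

Variables (M : nat) (D s E : R).

Let base := ((k + k).+1 + 4)%N.

(** The output area after its first [t] cells are filled; cell [y * k + x] belongs to symbol [y] and
    input [x]. *)
Definition written t j : R :=
  if (j < t)%N then entry M s E (j %/ k) (rin (j %% k)) (rin (k + j %% k)) else 0.

Lemma writtenS y x : (x < k)%N ->
  update (written (y * k + x)) (y * k + x)%N (entry M s E y (rin x) (rin (k + x))) =
  written (y * k + x.+1).
Proof.
move=> xk; apply/funext => j; rewrite /update /written addnS ltnS.
have k0 : (0 < k)%N by case: k xk.
case: (ltngtP j (y * k + x)) => // ->.
by rewrite divnMDl// divn_small// addn0 modnMDl modn_small.
Qed.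

Lemma exec_row_loop b y : exec row_loop
  (mem [:: k; b; 0; M; y; base + y * k]%N [:: D; s; level R y; E] (written (y * k)))
  (mem [:: k; b; k; M; y; base + y.+1 * k]%N [:: D; s; level R y; E]
     (written (y.+1 * k)))
  (k * 5).+1.
Proof.
pose S x := mem [:: k; b; x; M; y; base + (y * k + x)]%N
  [:: D; s; level R y; E] (written (y * k + x)).
have -> : mem [:: k; b; 0; M; y; base + y * k]%N [:: D; s; level R y; E]
    (written (y * k)) = S 0%N by rewrite /S addn0.
have -> : mem [:: k; b; k; M; y; base + y.+1 * k]%N [:: D; s; level R y; E]
     (written (y.+1 * k)) = S k by rewrite /S mulSnr.
apply: (exec_while_iter (S := S)) => [x xk|]; last by rewrite /= ltnn.
split; first by [].
apply: (@exec_seq _ _ _ _ _ _ 2 2).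
  apply: (@exec_if_bool (in_bucket M y s (rin x) (rin (k + x)))).
    rewrite /in_bucket /exceeds.
    have eqexc l : beval (S x) (exceeds_exp l) =
        (reval (S x) l * (rin x + rin (k + x)) < s * (rin x - rin (k + x))).
      by rewrite -[LHS]/(reval _ l * (reval _ p_cell + reval _ q_cell) <
        reval _ (real_reg 1) * (reval _ p_cell - reval _ q_cell))
        eval_real_reg// (@eval_p _ _ _ x)// (@eval_q _ _ _ x).
    rewrite -[LHS]/(~~ beval _ (exceeds_exp (real_reg 2)) && ~~ ((y < M)%N &&
      ~~ beval _ (exceeds_exp (RDiv (real_reg 2) (RCast (IConst 16)))))).
    rewrite !eqexc -[reval _ (RDiv _ _)]/(reval _ (real_reg 2) / 16).
    by rewrite !eval_real_reg//= [level R y.+1]exprSr.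
  rewrite if_SetR; apply: (@exec_set_out _ (entry M s E y (rin x) (rin (k + x)))) => //.
  rewrite /entry; case: ifP => _; last by rewrite eval_real_reg.
  rewrite -[RHS]/(1%:R - reval _ (real_reg 3) * M%:R).
  by rewrite eval_real_reg.
rewrite writtenS//.
apply: (@exec_seq _ _ _ _ _ _ 1 1).
  exact: (@exec_set_index 5).
have -> : S x.+1 = mem (set_nth 0%N
   (set_nth 0%N [:: k; b; x; M; y; base + (y * k + x)]%N 5 (base + (y * k + x) + 1)%N)
    2 (x + 1)%N) [:: D; s; level R y; E] (written (y * k + x.+1)).
  by rewrite /S/= !addn1 !addnS.
exact: (@exec_set_index 2).
Qed.

Lemma exec_matrix_loop b : exec matrix_loop
  (mem [:: k; b; k; M; 0; base]%N [:: D; s; 1; E] (fun=> 0))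
  (mem [:: k; b; k; M; M.+1; base + M.+1 * k]%N [:: D; s; level R M.+1; E]
     (written (M.+1 * k)))
  (M.+1 * (k * 5 + 5)).+1.
Proof.
pose S y := mem [:: k; b; k; M; y; base + y * k]%N
  [:: D; s; level R y; E] (written (y * k)).
have -> : mem [:: k; b; k; M; 0; base]%N [:: D; s; 1; E] (fun=> 0) = S 0%N.
  by rewrite /S addn0 /level expr0; congr mem; apply/funext => j.
rewrite addnS.
apply: (exec_while_iter (S := S)) => [y yM|]; last by rewrite /= addn1 ltnn.
split; first by rewrite /= addn1.
rewrite (_ : k * 5 + 4 = 1 + ((k * 5).+1 + (1 + 1)))%N; last lia.
apply: exec_seq; first exact: (@exec_set_index 2 _ 0%N).
apply: exec_seq; first exact: exec_row_loop.
apply: exec_seq.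
  apply: (@exec_set_real _ _ (level R y.+1)) => //.
  rewrite -[RHS]/(reval _ (real_reg 2) / 16) eval_real_reg//.
  by rewrite [LHS]exprSr.
have -> : S y.+1 = mem (set_nth 0%N [:: k; b; k; M; y; base + y.+1 * k]%N 4 (y + 1)%N)
    [:: D; s; level R y.+1; E] (written (y.+1 * k)).
  by rewrite /S addn1.
exact: (@exec_set_index 4).
Qed.

End Execution.

Section Program.
Variables (R : realType) (k : nat) (p q : {ffun 'I_k -> R}) (eps : R) (M : nat).

Let rin : nat -> R :=
  nth 0 ([seq p i | i <- enum 'I_k] ++ [seq q i | i <- enum 'I_k] ++ [:: eps]).

Lemma input_p (x : 'I_k) : rin x = p x.
Proof.
rewrite /rin nth_cat size_map size_enum_ord ltn_ord (nth_map x) ?size_enum_ord//.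
by rewrite nth_ord_enum.
Qed.

Lemma input_q (x : 'I_k) : rin (k + x) = q x.
Proof.
rewrite /rin nth_cat size_map size_enum_ord ifF; last lia.
rewrite addKn nth_cat size_map size_enum_ord ltn_ord (nth_map x) ?size_enum_ord//.
by rewrite nth_ord_enum.
Qed.

Lemma input_mem :
  input p q eps = mem k rin [:: k; 0; 0; 0; 0; 0]%N [:: 0; 0; 0; 0] (fun=> 0).
Proof.
rewrite /input /mem; congr State; apply/funext => j.
  by rewrite /update; do 6 (case: j => [|j]//); rewrite /= nth_nil.
case: ifP => // j1; rewrite nth_default; last first.
  have sz (r : {ffun 'I_k -> R}) : size [seq r i | i <- enum 'I_k] = k.
    by rewrite size_map size_enum_ord.
  by rewrite !size_cat !sz/=; lia.
by case: ifP => // j2; case: (j - _)%N => [|[|[|[|i]]]] //=; rewrite nth_nil.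
Qed.

(** The value 0 beyond row [M] matters because the output domain may have more than [M + 1]
    symbols. *)
Lemma exec_program : (0 < M)%N ->
  (forall m, (0 < m < M)%N -> 256 ^+ m * divergence p q < 8) ->
  8 <= 256 ^+ M * divergence p q ->
  exists2 s : state R,
    exec program (input p q eps) s (k * 10 + M * 8 + M * k * 5 + 13) &
    forall (x : 'I_k) y, rmem s (imem s 1%N + y * k + x)%N =
      if (y <= M)%N then entry M (side p q) (noise p q M) y (p x) (q x) else 0.
Proof.
move=> M0 lt8 ge8; set b := ((k + k).+1 + 4)%N.
exists (mem k rin [:: k; b; k; M; M.+1; b + M.+1 * k]%N
    [:: divergence p q; side p q; level R M.+1; noise p q M]
    (written k rin M (side p q) (noise p q M) (M.+1 * k))); last first.
  move=> x y /=; rewrite -/b ifF; last by rewrite /b; lia.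
  rewrite ifF; last by rewrite /b; lia.
  have k0 : (0 < k)%N by case: (x) => i; lia.
  rewrite -addnA addKn /written divnMDl// divn_small// addn0 modnMDl modn_small//.
  rewrite input_p input_q; congr (if _ then _ else _).
  apply/idP/idP => h; last first.
    by rewrite mulSn [ltnRHS]addnC -addnS leq_add// leq_mul2r h orbT.
  rewrite leqNgt; apply/negP => My.
  by have := leq_mul2r k M.+1 y; rewrite My orbT; lia.
rewrite input_mem.
(* One summand for each command of [program], in order. *)
have -> : (k * 10 + M * 8 + M * k * 5 + 13 =
  1 + (1 + ((k * 5).+1 + (2 + (1 + (1 + ((M.-1 * 3).+1 + (1 + (1 + (M.+1 * (k * 5 + 5)).+1)))))))))%N by lia.
have bE ir rr out : nth 0%N ir 0 = k -> ieval (mem k rin ir rr out) (scratch_addr 4) = b.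
  by move=> /= ->; rewrite /b; lia.
apply: exec_seq; first by apply: (@exec_set_index _ _ _ 1 _ b); rewrite bE.
apply: exec_seq; first by apply: (@exec_set_index _ _ _ 5 _ b); rewrite bE.
apply: exec_seq; first exact: exec_divergence_loop.
have -> : \sum_(j < k) triangular (rin j) (rin (k + j)) = divergence p q.
  by apply: eq_bigr => x _; rewrite input_p input_q.
have -> : \sum_(j < k) signed_triangular (rin j) (rin (k + j)) = imbalance p q.
  by apply: eq_bigr => x _; rewrite input_p input_q.
apply: exec_seq; first exact: exec_set_side.
rewrite -/(side p q).
apply: exec_seq; first exact: (@exec_set_index _ _ _ 3 _ 1%N).
apply: exec_seq.
  apply: (@exec_set_real _ _ _ 2 _ (divergence p q * 256)) => //.
  by rewrite -[RHS]/(reval _ (real_reg 0) * 256) eval_real_reg.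
apply: exec_seq; first exact: exec_depth_loop.
apply: exec_seq.
  apply: (@exec_set_real _ _ _ 3 _ (noise p q M)) => //.
  by rewrite -[RHS]/(reval _ (real_reg 0) / (512 * M%:R)) eval_real_reg.
apply: exec_seq; first exact: (@exec_set_real _ _ _ 2 _ 1).
exact: exec_matrix_loop.
Qed.

End Program.

(** * Conclusion *)

Section Assembly.
Variable R : realType.

Lemma exists_least (P : nat -> Prop) : (exists n, P n) -> exists n, is_least P n.
Proof.
move=> [m Pm]; have exP : exists n, `[< P n >] by exists m; apply/asboolP.
case: (ex_minnP exP) => n /asboolP Pn n_min; exists n; split=> // j Pj.
by apply: n_min; apply/asboolP.
Qed.

(** By induction [(1 - x)^n (1 + n x) <= 1], and here [1 + n x >= 10]. *)
Lemma expr_compl_small (x : R) n : 0 <= x <= 1 -> 9 <= n%:R * x ->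
  (1 - x) ^+ n <= 10^-1.
Proof.
move=> /andP[x0 x1] nx.
have : (1 - x) ^+ n * (1 + n%:R * x) <= 1.
  elim: (n) => [|m IH]; first by rewrite mul0r addr0 mulr1.
  apply: le_trans IH; rewrite exprSr -mulrA.
  rewrite ler_wpM2l ?exprn_ge0 ?subr_ge0// -natr1.
  by have : 0 <= m%:R :> R by []; nra.
have : 0 <= (1 - x) ^+ n by rewrite exprn_ge0 ?subr_ge0.
by nra.
Qed.

(** From [exp(-1/2) >= 1 - 1/2] follows [exp(1/2) <= 2], hence [e <= 4]. *)
Lemma expR_le_expr4 n : expR (n%:R : R) <= 4 ^+ n.
Proof.
rewrite -[n%:R]mulr1 expRM_natl lerXn2r ?nnegrE ?expR_ge0//.
have half : expR (2^-1 : R) <= 2.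
  have : 2^-1 <= expR (- 2^-1 : R).
    by apply: le_trans (expR_ge1Dx _); lra.
  by rewrite expRN lef_pV2 ?posrE ?expR_gt0.
have -> : (1 : R) = 2^-1 + 2^-1 by field.
by rewrite expRD; have := expR_ge0 (2^-1 : R); nra.
Qed.

Lemma lt_ln_expr4 n (x : R) : 4 ^+ n < x -> n%:R < ln x.
Proof.
move=> nx; have x0 : 0 < x by apply: le_lt_trans nx; rewrite exprn_ge0.
by rewrite -[n%:R]expRK ltr_ln ?posrE ?expR_gt0//;
  exact: le_lt_trans (expR_le_expr4 n) nx.
Qed.

Lemma lt_absz_ceil M (x : R) : M%:R < x -> (M < `|Num.ceil x|)%N.
Proof.
move=> Mx; have : M%:Z%:~R < (Num.ceil x)%:~R :> R.
  exact: lt_le_trans Mx (ceil_ge _).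
by rewrite ltr_int; case: (Num.ceil x).
Qed.

Lemma distr_card_gt0 k (p : {ffun 'I_k -> R}) : is_distr p -> (0 < k)%N.
Proof.
case: k p => // p [_]; rewrite big_ord0 => /eqP.
by rewrite eq_sym oner_eq0.
Qed.

(** With [t = k + l >= 1], each of [k], [M], [M k] and 1 is at most [t^2], and
    [10 + 8 + 5 + 13 = 36]. *)
Lemma program_time_bound k M (l : R) : (0 < k)%N -> 0 <= l -> M%:R <= k%:R + l ->
  (k * 10 + M * 8 + M * k * 5 + 13)%:R <= 36 * (k%:R + l) ^+ 2.
Proof.
rewrite -(ler1n R) => k1 l0 Mt; rewrite !natrD !natrM.
move: Mt; set t := k%:R + l => Mt.
have kt : k%:R <= t by rewrite lerDl.
have Mk : M%:R * k%:R <= t * t :> R by rewrite ler_pM.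
have t1 : 1 <= t by exact: le_trans kt.
have : t <= t * t by rewrite ler_peMr//; lra.
by rewrite expr2; lra.
Qed.

Lemma nat_above (x : R) : 0 <= x -> exists n, x < n%:R <= x + 1.
Proof.
move=> x0; exists (Num.truncn x).+1.
by have /andP[le gt] := truncn_itv x0; rewrite gt -natr1 lerD2r.
Qed.

Lemma depth_exists (d : R) : 0 < d -> exists M, [/\ (0 < M)%N,
  forall m, (0 < m < M)%N -> 256 ^+ m * d < 8 & 8 <= 256 ^+ M * d].
Proof.
move=> d0; have exM : exists m, (0 < m)%N && (8 <= 256 ^+ m * d).
  have [n /andP[/ltW n8 _]] := @nat_above (8 / d) (divr_ge0 (ler0n _ _) (ltW d0)).
  exists n.+1; rewrite -ler_pdivrMr//=; apply: le_trans n8 _.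
  by rewrite -natrX ler_nat ltnW// ltnW// ltn_expl.
case: (ex_minnP exM) => M /andP[M0 M8] M_min; exists M; split=> // m /andP[m0 mM].
by rewrite ltNge; apply: contraTN mM => m8; rewrite -leqNgt M_min ?m0.
Qed.

(** For [M = m + 2], minimality gives [256^(m+1) d < 8], and [256^(m+1) = 64^m * 16 * 4^M], so even
    [4^M d < 1/2]. *)
Lemma depth_bound M (d : R) : (0 < M)%N ->
  (forall m, (0 < m < M)%N -> 256 ^+ m * d < 8) -> M = 1%N \/ 4 ^+ M * d < 1.
Proof.
case: M => [//|[|m]] _ lt8; first by left.
right; have := lt8 m.+1; rewrite ltnSn => /(_ isT).
have -> : 256 ^+ m.+1 = 64 ^+ m * (16 * 4 ^+ m.+2) :> R.
  have -> : 256 = 64 * 4 :> R by ring.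
  by rewrite exprMn !exprS; ring.
have : 1 <= 64 ^+ m :> R by rewrite exprn_ege1// ler1n.
have : 0 < 4 ^+ m.+2 :> R by rewrite exprn_gt0.
set u := 4 ^+ _; set v := 64 ^+ _ => u0 v1 lt.
rewrite ltNge; apply: contraL lt => ud; rewrite -leNgt.
have -> : v * (16 * u) * d = 16 * v * (u * d) by ring.
by nra.
Qed.

Lemma hellinger2_gt0 (X : finType) (p q : {ffun X -> R}) :
  is_distr p -> is_distr q -> p <> q -> 0 < hellinger2 p q.
Proof.
move=> [p0 _] [q0 _] pq; rewrite lt_neqAle hellinger2_ge0 andbT eq_sym.
apply: contra_notN pq; rewrite psumr_eq0; last by move=> x _; exact: sqr_ge0.
move=> /allP h0; apply/ffunP => x.
have := h0 x (mem_index_enum x); rewrite sqrf_eq0 subr_eq0 => /eqP.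
by move=> /(congr1 (fun y => y ^+ 2)); rewrite !sqr_sqrtr.
Qed.

End Assembly.

Theorem theorem1p13 (R : realType) :
  exists (C c : R) (prog : cmd) (a b : nat),
    0 < C /\ 0 < c /\
    forall (k : nat) (p q : {ffun 'I_k -> R}) (eps : R),
      is_distr p -> is_distr q -> p <> q ->
      C * privacy_level (hellinger2 p q) <= expR eps ->
      exists n neps : nat,
        [/\ sample_complexity p q n,
            private_sample_complexity p q eps neps,
            within_factor c neps n &
            exists T : channel R 'I_k 'I_(domain_size R n),
              [/\ LDP eps T,
                  achieves p q T c neps &
                  computes_within prog p q eps T
                    (a%:R * (k%:R + ln n%:R) ^+ b)]].
Proof.
(* Opaque, so that no tactic unfolds it to a unary numeral. *)
have [N NE] : exists N : R, N = 9 * 1024 by eexists.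
(* The factor 512 is that of [noise], and 32 covers the case [M = 1]. [N] is 9 from
   [expr_compl_small] times 1024 from [quantizer_affinity]; the added 2 absorbs rounding [N / d] up,
   as [d <= 2]. *)
exists (512 * 32), (N + 2), program, 36%N, 2%N; split; first by lra.
split; first by rewrite NE; lra.
move=> k p q eps dp dq pq privacy.
have h0 := hellinger2_gt0 dp dq pq.
have hd := hellinger2_le_divergence dp dq.
have d2 := divergence_le2 dp dq.
set h := hellinger2 p q in h0 hd privacy *.
set d := divergence p q in hd d2 *.
have d0 : 0 < d by exact: lt_le_trans hd.
have [M [M0 M_min M_large]] := depth_exists d0.
have depth := depth_bound M0 M_min.
have M1 : 1 <= M%:R :> R by rewrite ler1n.
have K0 := quantizer_ge0 dp dq M0.
have K1 := quantizer_sum1 M dp dq.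
(* All entries lie between [noise] and 1, so it suffices that [expR eps * noise >= 1]. *)
have private x x' z : quantizer p q x z <= expR eps * quantizer p q (M := M) x' z.
  apply: (@le_trans _ _ 1); first exact: quantizer_le1.
  apply: (@le_trans _ _ (expR eps * noise p q M)); last first.
    by rewrite ler_wpM2l ?expR_ge0// quantizer_ge_noise.
  have M512 : 0 < 512 * M%:R :> R by lra.
  rewrite /noise -/d mulrA ler_pdivlMr// [leLHS]mul1r.
  apply: le_trans (ler_wpM2r (ltW d0) privacy).
  (* If [M = 1], then [M_large] gives [d >= 1/32]. Otherwise [4^M < 1/d <= 1/h], so [M < ln(1/h)]
     and [M <= privacy_level h * d]. *)
  have [M_1|Md] := depth.
    have : 1 <= privacy_level h by rewrite le_max lexx.
    by move: M_large; rewrite M_1 expr1; nra.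
  have : M%:R * h^-1 <= privacy_level h.
    rewrite le_max; apply/orP; right.
    rewrite mulrC ler_wpM2l ?invr_ge0 ?(ltW h0)//; apply: ltW.
    apply: lt_ln_expr4; rewrite -[h^-1]mul1r ltr_pdivlMr//; apply: le_lt_trans Md.
    by rewrite ler_wpM2l ?exprn_ge0.
  rewrite ler_pdivrMr// => lvl.
  have lvl0 : 0 <= privacy_level h by rewrite le_max ler01.
  have : privacy_level h * h <= privacy_level h * d by rewrite ler_wpM2l.
  by lra.
have affinity := quantizer_affinity dp dq M0 M_large.
rewrite -/d in affinity.
have [tau tauE] : exists tau, tau = d / 1024 by eexists.
rewrite -tauE in affinity.
have tau01 : 0 <= tau <= 1 by rewrite tauE; lra.
have N0 : 0 < N by rewrite NE; lra.
have [n1 /andP[n1_gt n1_le]] : exists n1, N / d < n1%:R <= N / d + 1.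
  by apply: nat_above; rewrite divr_ge0// ltW.
have small : (\sum_z Num.sqrt (out_law (quantizer p q (M := M)) p z *
    out_law (quantizer p q (M := M)) q z)) ^+ n1 <= 10^-1.
  apply: (@le_trans _ _ ((1 - tau) ^+ n1)).
    apply: lerXn2r; rewrite ?nnegrE//; first exact: sumr_ge0.
    by case/andP: tau01; rewrite subr_ge0.
  apply: expr_compl_small => //.
  by move: n1_gt; rewrite ltr_pdivrMr// tauE NE; lra.
have n1h : n1%:R * h <= (N + 2).
  have := n1_le.
  have -> : N / d + 1 = (N + d) / d by field; rewrite gt_eqF.
  rewrite ler_pdivlMr// => n1d.
  apply: (@le_trans _ _ (n1%:R * d)); first by rewrite ler_wpM2l.
  by lra.
(* Stated for any injection: into [nat] it bounds the private sample complexity, into the small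
   domain it shows that the final channel achieves it. *)
have succeeds (Y : countType) (g : 'I_M.+1 -> Y) (g_inj : injective g) :
    exists phi : {ffun 'I_n1 -> Y} -> bool,
      test_succeeds p q (fun=> push_channel K0 K1 g_inj) phi.
  by eexists; apply: likelihood_test_succeeds; [exact: dp.1|exact: dq.1|exact: small].
have n1_private : testable p q (fun T => LDP eps T) n1.
  exists (fun=> push_channel K0 K1 (@ord_inj M.+1)); split; last exact: succeeds.
  by move=> _; exact: push_channel_LDP.
have [neps neps_least] := exists_least (ex_intro _ n1 n1_private).
have [n n_least] : exists n, sample_complexity p q n.
  apply: exists_least; exists n1.
  by have [T [_ phi]] := n1_private; exists T.
have n_neps : (n <= neps)%N.
  apply: n_least.2; have [T [_ phi]] := neps_least.1; by exists T.
have neps_n1 : (neps <= n1)%N by exact: neps_least.2.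
have nh : 1 <= n%:R * h := testable_lower_bound dp dq n_least.1.
(* [n1 h <= N + 2 <= (N + 2) n h]. Together with [n <= neps <= n1] this makes all three
   comparable. *)
have n1_n : n1%:R <= (N + 2) * n%:R :> R.
  rewrite -(ler_pM2r h0); apply: (le_trans n1h).
  by rewrite -mulrA ler_peMr//; lra.
have n0 : (0 < n)%N by rewrite lt0n; apply/eqP => n0; move: nh; rewrite n0 mul0r ler10.
have n_neps' : n%:R <= neps%:R :> R by rewrite ler_nat.
have neps_n1' : neps%:R <= n1%:R :> R by rewrite ler_nat.
have n1' : 1 <= n%:R :> R by rewrite ler1n.
have grow m : m%:R <= (N + 2) * m%:R by rewrite ler_peMl//; lra.
have n_nepsN : (N + 2) * n%:R <= (N + 2) * neps%:R by rewrite ler_wpM2l//; lra.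
exists n, neps; split=> //.
  by split; [|have := grow neps]; lra.
(* Unless [M = 1], [4^M h <= 4^M d < 1 <= n h], so [4^M < n]. *)
have M_ln : M = 1%N \/ M%:R < ln (n%:R : R).
  have [|Md] := depth; [by left | right; apply: lt_ln_expr4].
  rewrite -(ltr_pM2r h0); apply: lt_le_trans nh; apply: le_lt_trans Md.
  by rewrite ler_wpM2l ?exprn_ge0.
(* For [M = 1] the two symbols fit because of the lower bound 2 in [domain_size]. *)
have MD : (M < domain_size R n)%N.
  rewrite /domain_size leq_max; case: M_ln => [->//|Mln].
  by rewrite (lt_absz_ceil Mln) orbT.
have winj : injective (widen_ord MD) by move=> x y /(congr1 val)/= /val_inj.
exists (push_channel K0 K1 winj); split.
- exact: push_channel_LDP.
- exists n1; split; first by split; [|have := grow n1]; lra.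
  exact: succeeds.
have [s exec_s out_s] := exec_program eps M0 M_min M_large.
exists s, (k * 10 + M * 8 + M * k * 5 + 13)%N; split=> //.
- apply: program_time_bound (distr_card_gt0 dp) _ _; first exact: ln_ge0.
  case: M_ln => [->|/ltW/le_trans->//]; last by rewrite lerDr.
  by rewrite -[1%:R]addr0 lerD ?ln_ge0// ler1n (distr_card_gt0 dp).
- move=> x y; rewrite out_s /=; case: ifPn => yM.
    have -> : y = widen_ord MD (@Ordinal M.+1 y yM) by exact: val_inj.
    by rewrite push_kernE.
  (* A symbol above [M] is the image of no bucket, so its probability is 0, like the unwritten
     cells. *)
  rewrite /push_kern big_pred0// => z; apply/eqP => zy.
  by move: yM; rewrite -zy /= -ltnS ltn_ord.
Qed.
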